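(* Let $\sigma$ be a permutation of $[n]=\{1,\dots,n\}$, let $P_\sigma=\{(k,\sigma(k)) : 1\le k\le n\}$ with the partial order $(k,\sigma(k))\le(l,\sigma(l))$ iff $k\le l$ and $\sigma(k)\le\sigma(l)$, and for $1\le i\le j\le n$ let $\lambda_{[i;j]}=\lambda(P_\sigma[i;j])$, where $P_\sigma[i;j]=\{(k,\sigma(k)) : i\le k\le j\}$ with the induced order. Fix $1<i\le j<n$. Then $\lambda_{[i;j+1]}$ is uniquely determined by $\lambda_{[i-1;j]}$, $\lambda_{[i;j]}$ and $\lambda_{[i-1;j+1]}$, as follows: if there exists a partition (Young diagram) $\lambda\neq\lambda_{[i-1;j]}$ with $\lambda_{[i;j]}\subsetneq\lambda\subsetneq\lambda_{[i-1;j+1]}$, then $\lambda_{[i;j+1]}=\lambda$; otherwise $\lambda_{[i;j+1]}=\lambda_{[i-1;j]}$.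
   Context: For a finite poset $P$ and $k\ge 0$, let $c_k(P)$ denote the maximal cardinality of a union of $k$ chains of $P$ (a chain is a totally ordered subset), and set $\lambda_k=c_k-c_{k-1}$ for $k\ge1$. It is known that $\lambda(P)=(\lambda_1,\lambda_2,\dots)$ is a partition of $|P|$ (weakly decreasing), identified with its Young diagram (Ferrers shape); containment $\subset$ of shapes means containment of Young diagrams. *)

(* Defs.v *)
From HB Require Import structures.
From mathcomp Require Export all_boot all_order all_fingroup.

Set Implicit Arguments.
Unset Strict Implicit.
Unset Printing Implicit Defensive.

Import Order.Theory.

(* A finite poset is given as a subset P of an ambient finite poset T, with   *)
(* the induced order.                                                         *)
Section GreeneShape.

Variables (d : Order.disp_t) (T : finPOrderType d).
Implicit Types (P C : {set T}) (k : nat).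

Definition is_chain C := [forall x in C, forall y in C, (x >=< y)%O].

(* The chains of a family may be empty or overlap, so max_chains P is         *)
(* nondecreasing in k and max_chains P 0 = 0.                                 *)
Definition max_chains P k :=
  \max_(F : {ffun 'I_k -> {set T}} |
         [forall i, (F i \subset P) && is_chain (F i)])
     #|\bigcup_i F i|.

(* Rows are numbered from 0: greene_shape P k is lambda_(k+1) = c_(k+1) - c_k *)
(* in the usual numbering; the subtraction never truncates.                   *)
Definition greene_shape P k := max_chains P k.+1 - max_chains P k.

End GreeneShape.

(* Integer partitions (Young diagrams) are infinite sequences of row lengths, *)
(* compared extensionally.                                                    *)
Definition is_partition (lam : nat -> nat) : Prop :=
  (forall k, lam k.+1 <= lam k) /\ (exists N, forall k, N <= k -> lam k = 0).

Definition subshape (lam mu : nat -> nat) : Prop := forall k, lam k <= mu k.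

Definition propshape (lam mu : nat -> nat) : Prop :=
  subshape lam mu /\ ~ (lam =1 mu).

Definition other_intermediate (side inner outer lam : nat -> nat) : Prop :=
  [/\ is_partition lam, ~ (lam =1 side), propshape inner lam
    & propshape lam outer].

Definition local_rule (side inner outer rho : nat -> nat) : Prop :=
  (forall lam, other_intermediate side inner outer lam -> rho =1 lam) /\
  (~ (exists lam, other_intermediate side inner outer lam) -> rho =1 side).

(* P_sigma[i;j], inside 'I_n x 'I_n with the componentwise order. The bounds  *)
(* i and j are 1-based: the ordinal k stands for the element k.+1 of [n].     *)
Definition perm_poset n (sigma : 'S_n) (i j : nat) : {set 'I_n *p 'I_n} :=
  [set ((k, sigma k) : 'I_n *p 'I_n) | k : 'I_n & i <= k.+1 <= j].

Definition perm_shape n (sigma : 'S_n) (i j : nat) : nat -> nat :=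
  greene_shape (perm_poset sigma i j).

(* Main.v *)
Require Import Defs.
From mathcomp Require Import zify.

(** Write c_k(P) for the maximal size of a union of k chains, P for
    P_sigma[i-1;j+1], p and q for its leftmost and rightmost points.  Chains
    of P are the antichains of the conjugate order "to the right and below",
    and a union of k antichains is the same thing as a height function with
    values in [0, k]; pointwise minima and maxima of (shifted) height functions
    show that c_k is concave in k, that adding p or q to a shape adds one box,
    and that
      c_k(P) + c_k(P \ {p, q}) <= c_k(P \ p) + c_k(P \ q).
    In the original order p is minimal and q is maximal; viewing chain families
    as partial injections and swapping two of them along the alternating path
    that starts at p gives, for some k' + l' = 2k,
      c_k(P \ p) + c_k(P \ q) <= c_k'(P) + c_l'(P \ {p, q}).
    If both side shapes add the same box to the inner shape, the outer shape can
    then have no second intermediate shape: the first inequality forbids a last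
    box strictly above the common one, the second forbids one that is strictly
    below and to the left. *)

Set Implicit Arguments.
Unset Strict Implicit.
Unset Printing Implicit Defensive.

Import Order.Theory.

Lemma card_setE (T : finType) (P : {set T}) (R : pred T) :
  #|[set x in P | R x]| = \sum_(x in P) (R x : nat).
Proof.
rewrite -sum1_card [RHS]big_mkcond [LHS]big_mkcond; apply: eq_bigr => x _.
by rewrite inE; case: (x \in P); case: (R x).
Qed.

(** * Elementary properties of c_k *)

Section MaxChains.
Variables (d : Order.disp_t) (T : finPOrderType d).
Implicit Types (P Q C : {set T}) (k : nat).

Lemma is_chainP C :
  reflect {in C &, forall x y, (x >=< y)%O} (is_chain C).
Proof.
apply: (iffP forall_inP) => [h x y Cx Cy|h x Cx];
  first exact: (forall_inP (h x Cx)).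
by apply/forall_inP => y Cy; apply: h.
Qed.

Lemma max_chains_ge P k (F : 'I_k -> {set T}) :
    (forall i, F i \subset P) -> (forall i, is_chain (F i)) ->
  #|\bigcup_i F i| <= max_chains P k.
Proof.
move=> sFP chF; pose G := [ffun i => F i].
have -> : \bigcup_i F i = \bigcup_i G i by apply: eq_bigr => i _; rewrite ffunE.
rewrite /max_chains;
  apply: (leq_bigmax_cond (F :=
    fun G : {ffun 'I_k -> {set T}} => #|\bigcup_i G i|)).
by apply/forallP => i; rewrite ffunE sFP chF.
Qed.

Lemma max_chains_attained P k :
  exists F : 'I_k -> {set T},
    [/\ forall i, F i \subset P, forall i, is_chain (F i)
      & max_chains P k = #|\bigcup_i F i|].
Proof.
pose A := [pred F : {ffun 'I_k -> {set T}} | [forall i, (F i \subset P) && is_chain (F i)]].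
have A0 : 0 < #|A|.
  apply/card_gt0P; exists [ffun=> set0]; apply/forallP => i;
    rewrite ffunE sub0set.
  by apply/is_chainP => x y; rewrite inE.
have [F /forallP AF eF] :=
  eq_bigmax_cond (fun F : {ffun 'I_k -> {set T}} => #|\bigcup_i F i|) A0.
exists F; split=> [i|i|]; by [case/andP: (AF i) | rewrite -eF].
Qed.

Lemma max_chains_le_card P k : max_chains P k <= #|P|.
Proof.
have [F [sFP _ ->]] := max_chains_attained P k.
by apply/subset_leq_card/bigcupsP => i _.
Qed.

Lemma max_chains0 P : max_chains P 0 = 0.
Proof.
have [F [_ _ ->]] := max_chains_attained P 0.
by rewrite big_ord0 cards0.
Qed.

Lemma leq_max_chains P Q k : P \subset Q -> max_chains P k <= max_chains Q k.
Proof.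
move=> sPQ; have [F [sFP chF ->]] := max_chains_attained P k.
by apply: max_chains_ge => // i; apply: subset_trans (sFP i) sPQ.
Qed.

Lemma max_chains_homo P : {homo max_chains P : k l / k <= l}.
Proof.
move=> k l lekl; have [F [sFP chF ->]] := max_chains_attained P k.
pose G (i : 'I_l) := if insub (i : nat) is Some i' then F i' else set0.
have GF i : G i = set0 \/ exists i', G i = F i'.
  by rewrite /G; case: insubP => [i' _ _|_]; [right; exists i' | left].
apply: leq_trans (@max_chains_ge P l G _ _).
- apply/subset_leq_card/bigcupsP => i _.
  apply: (bigcup_max (widen_ord lekl i)) => //.
  by rewrite /G (valK i : insub (widen_ord lekl i : nat) = Some i).
- by move=> i; case: (GF i) => [->|[i' ->]]; rewrite ?sub0set.
- by move=> i; case: (GF i) => [->|[i' ->]] //; apply/is_chainP => x y;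
    rewrite inE.
Qed.

Lemma max_chains_full P k : #|P| <= k -> max_chains P k = #|P|.
Proof.
move=> lePk; apply/eqP; rewrite eqn_leq max_chains_le_card /=.
apply: leq_trans (max_chains_homo P lePk).
apply: leq_trans (@max_chains_ge P #|P| (fun i => [set enum_val i]) _ _).
- apply/subset_leq_card/subsetP => x Px; apply/bigcupP.
  by exists (enum_rank_in Px x); rewrite // inE enum_rankK_in.
- by move=> i; rewrite sub1set enum_valP.
- by move=> i; apply/is_chainP => x y /set1P -> /set1P ->; rewrite comparablexx.
Qed.

Lemma max_chainsD1 P q k : max_chains P k <= (max_chains (P :\ q) k).+1.
Proof.
have [F [sFP chF ->]] := max_chains_attained P k.
rewrite (cardsD1 q) -addn1 addnC; apply: leq_add; last exact: leq_b1.
apply: leq_trans (@max_chains_ge (P :\ q) k (fun i => F i :\ q) _ _).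
- apply/subset_leq_card/subsetP => x /setD1P [xq /bigcupP [i _ Fx]].
  by apply/bigcupP; exists i; rewrite // in_setD1 xq.
- by move=> i; apply: setSD.
- move=> i; apply/is_chainP => x y /setD1P [_ Fx] /setD1P [_ Fy].
  exact: (is_chainP _ (chF i)).
Qed.

End MaxChains.

(** * Height functions for a conjugate order *)

Section Labellings.
Variables (d : Order.disp_t) (T : finPOrderType d) (prec : rel T).
Hypothesis prec_trans : transitive prec.
Implicit Types (P Q : {set T}) (k : nat) (a b : T -> nat).

(** Chains inside P are thus the [prec]-antichains; the case x = y makes [prec] irreflexive on P. *)
Definition conjugate_on P :=
  {in P &, forall x y, (x >=< y)%O = ~~ (prec x y || prec y x)}.

Lemma conjugate_onS P Q : P \subset Q -> conjugate_on Q -> conjugate_on P.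
Proof. by move=> /subsetP sPQ cQ x y /sPQ Qx /sPQ Qy; apply: cQ. Qed.

(* The two values of a height function just before and just after [x]; they
   differ exactly when [x] belongs to the family of chains it encodes. *)
Definition labelling P a b := {in P &, forall x y, prec x y -> b x <= a y}.

Definition covered P a b := [set x in P | a x < b x].

(** The i-th chain is the level set of the x whose interval [a x, b x) contains m + i: intervals of
    [prec]-related points are disjoint, so a level set is a [prec]-antichain. *)
Lemma labelling_chains P a b m k :
    conjugate_on P -> labelling P a b ->
    {in P, forall x, a x < b x -> (m <= a x) && (b x <= m + k)} ->
  #|covered P a b| <= max_chains P k.
Proof.
move=> cP lab bnd.
pose F (i : 'I_k) := [set x in P | a x <= m + i < b x].
apply: leq_trans (@max_chains_ge _ _ P k F _ _).
- apply/subset_leq_card/subsetP => x; rewrite inE => /andP [Px ab].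
  have /andP [ma bk] := bnd x Px ab.
  have ltk : a x - m < k by lia.
  by apply/bigcupP; exists (Ordinal ltk); rewrite // inE Px /=; lia.
- by move=> i; apply/subsetP => x; rewrite inE => /andP [].
- move=> i; apply/is_chainP => x y; rewrite !inE => /andP [Px hx] /andP [Py hy].
  rewrite cP //; apply/norP; split; apply/negP => /lab;
    [move=> /(_ Px Py)|move=> /(_ Py Px)]; lia.
Qed.

(** Here [a x] counts the chains that meet the strict [prec]-down-set of x, and [b x] adds those
    through x. A chain through x is missed by [a x] because it is a [prec]-antichain. *)
Lemma chains_labelling P k :
    conjugate_on P ->
  exists a b, [/\ labelling P a b, forall x, a x <= b x <= k
                & max_chains P k <= #|covered P a b|].
Proof.
move=> cP; have [F [sFP chF ->]] := max_chains_attained P k.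
exists (fun x => #|[set i | [exists y in F i, prec y x]]|).
exists (fun x => #|[set i | [exists y in F i, (y == x) || prec y x]]|).
split.
- move=> x y Px Py xy; apply/subset_leq_card/subsetP => i.
  rewrite !inE => /exists_inP [z Fz zx]; apply/exists_inP; exists z => //.
  by case/orP: zx => [/eqP -> //|zx]; apply: prec_trans zx xy.
- move=> x; apply/andP; split; last by rewrite -[leqRHS]card_ord max_card.
  apply/subset_leq_card/subsetP => i; rewrite !inE => /exists_inP [z Fz zx].
  by apply/exists_inP; exists z => //; rewrite zx orbT.
- apply/subset_leq_card/subsetP => x /bigcupP [i _ Fx].
  have Px : x \in P by apply: (subsetP (sFP i)).
  rewrite inE Px; apply/proper_card/properP; split.
    apply/subsetP => l; rewrite !inE => /exists_inP [z Fz zx].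
    by apply/exists_inP; exists z => //; rewrite zx orbT.
  exists i; rewrite !inE; first by apply/exists_inP; exists x; rewrite ?eqxx.
  apply/exists_inP => -[y Fy yx]; have Py : y \in P by apply: (subsetP (sFP i)).
  by have := is_chainP _ (chF i) x y Fx Fy; rewrite cP // yx orbT.
Qed.

(** This holds point by point. Minimum and maximum preserve the total length of the two intervals,
    so one nonempty interval leaves one nonempty; if both are nonempty, both remain so. *)
Lemma card_covered_min_max P a b a' b' :
    {in P, forall x, a x <= b x} -> {in P, forall x, a' x <= b' x} ->
  #|covered P a b| + #|covered P a' b'| <=
    #|covered P (fun x => minn (a x) (a' x)) (fun x => minn (b x) (b' x))| +
    #|covered P (fun x => maxn (a x) (a' x)) (fun x => maxn (b x) (b' x))|.
Proof.
move=> ab ab'; rewrite !card_setE -!big_split; apply: leq_sum => x Px /=.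
by move: (ab x Px) (ab' x Px); lia.
Qed.

Lemma labelling_min P a b a' b' : labelling P a b -> labelling P a' b' ->
  labelling P (fun x => minn (a x) (a' x)) (fun x => minn (b x) (b' x)).
Proof. by move=> l l' x y Px Py xy; move: (l x y Px Py xy) (l' x y Px Py xy);
  lia. Qed.

Lemma labelling_max P a b a' b' : labelling P a b -> labelling P a' b' ->
  labelling P (fun x => maxn (a x) (a' x)) (fun x => maxn (b x) (b' x)).
Proof. by move=> l l' x y Px Py xy; move: (l x y Px Py xy) (l' x y Px Py xy);
  lia. Qed.

Lemma max_chains_concave P k : conjugate_on P ->
  max_chains P k + max_chains P k.+2 <= (max_chains P k.+1).*2.
Proof.
move=> cP; have [a [b [lab bnd hc]]] := chains_labelling k cP.
have [a' [b' [lab' bnd' hc']]] := chains_labelling k.+2 cP.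
(* Shifted by 1, the first labelling has values in [1, k+1], so that its minimum
   and maximum with the second both span k+1 levels. *)
pose a1 x := (a x).+1; pose b1 x := (b x).+1.
have lab1 : labelling P a1 b1 by move=> x y Px Py xy; apply: lab.
have e1 : covered P a b = covered P a1 b1 by apply/setP => x; rewrite !inE.
have := @card_covered_min_max P a1 b1 a' b' _ _.
have hmin := labelling_chains (m := 0) (k :=
  k.+1) cP (labelling_min lab1 lab') _.
have hmax := labelling_chains (m := 1) (k :=
  k.+1) cP (labelling_max lab1 lab') _.
rewrite -e1 -addnn => h.
apply: leq_trans (leq_add hc hc') (leq_trans (h _ _) (leq_add (hmin _) (hmax _))) => x Px;
  move: (bnd x) (bnd' x); rewrite /a1 /b1 ?ltnS; lia.
Qed.

Lemma covered_sub P Q a b : Q \subset P ->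
  {in P, forall x, x \notin Q -> b x <= a x} -> covered P a b = covered Q a b.
Proof.
move=> /subsetP sQP h; apply/setP => x; rewrite !inE.
have [Qx|Qx] := boolP (x \in Q); first by rewrite sQP.
by case: (boolP (x \in P)) => //= Px; rewrite ltnNge h.
Qed.

(** This makes the gain c_k(P) - c_k(P \ q) weakly increasing in k. The labelling of P \ q is
    extended by 0 at q, so the minimum leaves q uncovered and keeps k levels, while the maximum
    spans k+1. *)
Lemma max_chains_addition_min P q k :
    conjugate_on P -> q \in P -> {in P, forall x, ~~ prec x q} ->
  max_chains P k + max_chains (P :\ q) k.+1 <=
    max_chains (P :\ q) k + max_chains P k.+1.
Proof.
move=> cP Pq minq; have cPq := conjugate_onS (subsetDl P [set q]) cP.
have [a [b [lab bnd hc]]] := chains_labelling k cP.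
have [a0 [b0 [lab0 bnd0 hc0]]] := chains_labelling k.+1 cPq.
pose a' x := if x == q then 0 else a0 x;
  pose b' x := if x == q then 0 else b0 x.
have lab' : labelling P a' b'.
  move=> x y Px Py xy; rewrite /a' /b'; have [//|xq] := eqVneq x q.
  have [yq|yq] := eqVneq y q; first by rewrite yq (negPf (minq x Px)) in xy.
  by apply: lab0; rewrite // in_setD1 ?xq ?yq.
have bnd' x : a' x <= b' x <= k.+1 by rewrite /a' /b'; case: eqP.
have e0 : covered (P :\ q) a0 b0 = covered P a' b'.
  apply/setP => x; rewrite !inE /a' /b'; case: eqVneq => [->|] //=;
    first by rewrite andbF.
have h := @card_covered_min_max P a b a' b' _ _.
have hmin := labelling_chains (m := 0) (k := k) cPq
  (sub_in2 (subsetP (subsetDl P [set q])) (labelling_min lab lab')) _.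
have hmax := labelling_chains (m := 0) (k :=
  k.+1) cP (labelling_max lab lab') _.
rewrite -(covered_sub (subsetDl P [set q])) in hmin; last first.
  move=> x Px; rewrite !inE Px andbT negbK => /eqP ->.
  by rewrite /a' /b' eqxx !minn0.
rewrite -e0 in h.
apply: leq_trans (leq_add hc hc0) (leq_trans (h _ _) (leq_add (hmin _) (hmax _))) => x Px;
  move: (bnd x) (bnd' x); lia.
Qed.

(** The labelling of P \ {p, q} is extended by the extreme values 0 at p and k at q. The minimum
    then leaves p uncovered and the maximum leaves q uncovered. *)
Lemma max_chains_submodular P p q k :
    conjugate_on P -> p \in P -> q \in P -> p != q ->
    {in P, forall x, ~~ prec x p} -> {in P, forall x, ~~ prec q x} ->
  max_chains P k + max_chains (P :\ p :\ q) k <=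
    max_chains (P :\ p) k + max_chains (P :\ q) k.
Proof.
move=> cP Pp Pq pq minp maxq.
have cPp := conjugate_onS (subsetDl P [set p]) cP.
have cPq := conjugate_onS (subsetDl P [set q]) cP.
have cPpq := conjugate_onS (subsetDl (P :\ p) [set q]) cPp.
have [a [b [lab bnd hc]]] := chains_labelling k cP.
have [a0 [b0 [lab0 bnd0 hc0]]] := chains_labelling k cPpq.
pose ext (f : T -> nat) x := if x == p then 0 else if x == q then k else f x.
pose a' := ext a0; pose b' := ext b0.
have bnd' x : a' x <= b' x <= k.
  by rewrite /a' /b' /ext; case: eqP => //; case: eqP; rewrite ?leqnn.
have lab' : labelling P a' b'.
  move=> x y Px Py xy.
  have yp : y != p by apply: contraTneq xy => ->; exact: minp.
  have xq : x != q by apply: contraTneq xy => ->; exact: maxq.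
  rewrite {1}/b' {1}/a' /ext (negPf yp) (negPf xq).
  have [//|xp] := eqVneq x p; have [yq|yq] := eqVneq y q;
    first by have := bnd0 x; lia.
  by apply: lab0; rewrite // !in_setD1 ?xp ?xq ?yp ?yq.
have e0 : covered (P :\ p :\ q) a0 b0 = covered P a' b'.
  apply/setP => x; rewrite !inE /a' /b' /ext.
  by case: (x == p); case: (x == q); rewrite /= ?ltnn ?andbF.
have h := @card_covered_min_max P a b a' b' _ _.
have hmin := labelling_chains (m := 0) (k := k) cPp
  (sub_in2 (subsetP (subsetDl P [set p])) (labelling_min lab lab')) _.
have hmax := labelling_chains (m := 0) (k := k) cPq
  (sub_in2 (subsetP (subsetDl P [set q])) (labelling_max lab lab')) _.
rewrite -(covered_sub (subsetDl P [set p])) in hmin; last first.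
  move=> x Px; rewrite !inE Px andbT negbK => /eqP ->.
  by rewrite /a' /b' /ext eqxx !minn0.
rewrite -(covered_sub (subsetDl P [set q])) in hmax; last first.
  move=> x Px; rewrite !inE Px andbT negbK => /eqP ->.
  by rewrite /a' /b' /ext eq_sym (negPf pq) eqxx; have := bnd q; lia.
rewrite -e0 in h.
apply: leq_trans (leq_add hc hc0) (leq_trans (h _ _) (leq_add (hmin _) (hmax _))) => x Px;
  move: (bnd x) (bnd' x); lia.
Qed.

End Labellings.

(** * Chain families as partial injections, and their exchange *)

Section Successions.
Variables (d : Order.disp_t) (T : finPOrderType d).
Implicit Types (P Q : {set T}) (k : nat) (f g : T -> option T).

(* [f x] is the successor of [x] in its chain, [None] if [x] ends its chain, and
   [Some x] if [x] lies on no chain. *)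
Definition succession P f :=
  {in P, forall x y, f x = Some y -> (y \in P) && (x <= y)%O} /\
  {in P &, forall x x', f x -> f x = f x' -> x = x'}.

Definition ends P f := [set x in P | f x == None].

Definition loops P f := [set x in P | f x == Some x].

Lemma chains_succession P k :
  exists f, [/\ succession P f, #|ends P f| <= k
              & #|loops P f| + max_chains P k <= #|P|].
Proof.
have [F [sFP chF ->]] := max_chains_attained P k.
(* Choosing one chain for each covered point makes the chains disjoint. *)
pose c x := [pick i | x \in F i].
have cF x i : c x = Some i -> x \in F i.
  by rewrite /c; case: pickP => // j Fj [<-].
have cmp x y : c x -> c x = c y -> (x >=< y)%O.
  case E: (c x) => [i|//] _ /esym E'.
  by apply: (is_chainP _ (chF i)); apply: cF.
pose above x z := (c z == c x) && (x < z)%O.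
pose next x := [pick y | above x y && [forall z, above x z ==> (y <= z)%O]].
pose f x := if c x then next x else Some x.
have fP x y : c x -> f x = Some y ->
    above x y /\ forall z, above x z -> (y <= z)%O.
  rewrite /f => ->; rewrite /next;
    case: pickP => // w /andP [aw /forallP mw] [<-].
  by split=> // z az; apply: (implyP (mw z)).
have fN x z : above x z -> f x != None.
  move=> axz; rewrite /f; case cx: (c x : bool) => //; rewrite /next;
    case: pickP => // none.
  (* Inside a chain, the point with the fewest points of T below it is the least one. *)
  case: (arg_minnP (fun z => #|[set w | (w < z)%O]|) axz) => m am minm.
  have /negP[] := negbT (none m); rewrite am /=; apply/forallP => y;
    apply/implyP => ay.
  have /andP [/eqP cm _] := am; have /andP [/eqP cy _] := ay.
  have := @cmp m y; rewrite cm cy => /(_ cx erefl).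
  case/orP => // ym; rewrite le_eqVlt; case: eqVneq => //= my.
  have ltym : (y < m)%O by rewrite lt_neqAle eq_sym my.
  have := minm y ay; rewrite leqNgt; case/negP; apply/proper_card/properP;
    split.
    by apply/subsetP => w; rewrite !inE => wy; apply: lt_trans ltym.
  by exists y; rewrite !inE ?ltxx.
(* If x < x' lie on one chain, the successor of x is at most x', while that of x' is strictly above
   x'. *)
have inj x x' : c x -> c x = c x' -> f x = f x' -> f x -> x = x'.
  move=> cx cc; case E: (f x) => [y|//] /esym E' _.
  have [/andP [_ xy] mx] := fP x y cx E.
  have [/andP [_ x'y] mx'] := fP x' y (etrans (esym (congr1 isSome cc)) cx) E'.
  apply/eqP; apply: contraT => xx'; case/orP: (cmp x x' cx cc) => le.
    have /mx : above x x' by rewrite /above cc eqxx lt_neqAle xx'.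
    by rewrite (lt_geF x'y).
  have /mx' : above x' x by rewrite /above cc eqxx lt_neqAle eq_sym xx'.
  by rewrite (lt_geF xy).
exists f; split; first split.
- move=> x Px y; case cx: (c x : bool); last by rewrite /f cx => -[<-];
    rewrite Px lexx.
  move=> /(fP x y cx) [/andP [/eqP cy xy] _]; rewrite (ltW xy) andbT.
  by move: cx; rewrite -cy; case E: (c y) => [i|//] _;
    apply: (subsetP (sFP i)); apply: cF.
- move=> x x' _ _ fx ff; case cx: (c x : bool).
    case E: (f x) fx => [y|//] _; have [/andP [/eqP cy xy] _] := fP x y cx E.
    case cx': (c x' : bool).
      have [/andP [/eqP cy' _] _] := fP x' y cx' (etrans (esym ff) E).
      by apply: inj; [| rewrite -cy -cy' | | rewrite E].
    by move: ff; rewrite E /f cx' => -[yx']; move: cx'; rewrite -yx' cy cx.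
  case cx': (c x' : bool); last by move: ff; rewrite /f cx cx' => -[].
  have fxx : f x = Some x by rewrite /f cx.
  have [/andP [/eqP cy _] _] := fP x' x cx' (etrans (esym ff) fxx).
  by rewrite -cy cx in cx'.
- have cends x : x \in ends P f -> c x.
    by rewrite inE => /andP [_]; rewrite /f; case: (c x : bool).
  rewrite -(card_in_imset (f := c)).
    apply: leq_trans (_ : #|[set~ None : option 'I_k]| <= k); last first.
      by rewrite cardsC1 card_option card_ord.
    apply/subset_leq_card/subsetP => o /imsetP [x /cends cx ->].
    by rewrite !inE; case: (c x) cx.
  move=> x y ex ey cc; apply/eqP; apply: contraT => xy.
  case/orP: (cmp x y (cends x ex) cc) => le.
    have /fN : above x y by rewrite /above cc eqxx lt_neqAle xy.
    by move: ex; rewrite inE => /andP [_ ->].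
  have /fN : above y x by rewrite /above cc eqxx lt_neqAle eq_sym xy.
  by move: ey; rewrite inE => /andP [_ ->].
- have sUP : \bigcup_i F i \subset P by apply/bigcupsP.
  have /subset_leq_card : loops P f \subset P :\: \bigcup_i F i.
    apply/subsetP => x; rewrite !inE => /andP [Px /eqP fx]; rewrite Px andbT.
    apply/bigcupP => -[i _ Fx]; have cx : c x by rewrite /c;
      case: pickP => // /(_ i) /negP.
    by have [/andP [_]] := fP x x cx fx; rewrite ltxx.
  by have := subset_leq_card sUP; rewrite cardsDS //; lia.
Qed.

(** Each end yields the chain of its iterated predecessors. Off the loops f strictly increases, so
    every point that is not a loop reaches an end. *)
Lemma succession_chains P f :
  succession P f -> #|P| <= #|loops P f| + max_chains P #|ends P f|.
Proof.
move=> [fP finj].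
(* A point without predecessor is sent to itself, so [pr] is total and can be iterated. *)
pose pr y := odflt y [pick x in P | f x == Some y].
have prP y : y \in P -> pr y \in P /\ (pr y <= y)%O.
  rewrite /pr; case: pickP => [x /andP [Px /eqP fx] _|_ //] /=.
  by rewrite Px; have /andP [] := fP x Px y fx.
have prK x y : x \in P -> f x = Some y -> pr y = x.
  move=> Px fx; rewrite /pr; case: pickP => [x' /andP [Px' /eqP fx']|/(_ x)] /=.
    by apply: finj; rewrite ?fx' ?fx.
  by rewrite Px fx eqxx.
have iterP n y : y \in P -> iter n pr y \in P /\ (iter n pr y <= y)%O.
  move=> Py; elim: n => [|n [Pn len]] //=; have [? le] := prP _ Pn.
  by split=> //; apply: le_trans len.
pose G (i : 'I_#|ends P f|) := [set x | fconnect pr (enum_val i) x].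
have Pe (i : 'I_#|ends P f|) : enum_val i \in P.
  by have := enum_valP i; rewrite inE => /andP [].
have GP i x : x \in G i -> exists n, x = iter n pr (enum_val i).
  by rewrite inE => /iter_findex <-; eexists.
(* Induction on a bound for the number of points above x; injectivity keeps the successor of x from
   being a loop. *)
have cov n x : #|[set z | (x < z)%O]| < n -> x \in P -> x \notin loops P f ->
    exists2 e, e \in ends P f & fconnect pr e x.
  elim: n x => // n IH x; rewrite ltnS => len Px; rewrite inE Px /= => nl.
  case E: (f x) => [y|]; last by exists x; rewrite ?connect0 // inE Px E.
  have /andP [Py lexy] := fP x Px y E.
  have xy : x != y by apply: contra nl => /eqP {2}->; rewrite E.
  have ltxy : (x < y)%O by rewrite lt_neqAle xy.
  have [|//||e ee ey] := IH y.
  - apply: leq_trans len; apply/proper_card/properP; split.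
      by apply/subsetP => w; rewrite !inE; apply: lt_trans.
    by exists y; rewrite !inE ?ltxx.
  - rewrite inE Py /=; apply: contra xy => /eqP fy; apply/eqP.
    by apply: finj; rewrite ?E ?fy.
  - exists e => //; apply: connect_trans ey _; rewrite -(prK x y) //;
      exact: fconnect1.
apply: leq_trans (leq_trans (leq_card_setU (loops P f) (\bigcup_i G i)) _).
  apply/subset_leq_card/subsetP => x Px; rewrite inE orbC -implyNb;
    apply/implyP => nU.
  apply: contraR nU => nl; have [e ee ex] := cov _ x (ltnSn _) Px nl.
  apply/bigcupP; exists (enum_rank_in ee e) => //.
  by rewrite inE enum_rankK_in.
rewrite leq_add2l; apply: max_chains_ge => i.
  by apply/subsetP => x /GP [n ->]; have [] := iterP n _ (Pe i).
apply/is_chainP => x y /GP [n ->] /GP [m ->].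
wlog le : n m / n <= m => [th|].
  by case/orP: (leq_total n m) => le; last rewrite comparable_sym; apply: th.
rewrite -(subnK le) iterD comparable_sym; apply: le_comparable.
by have [] := iterP (m - n) _ (iterP n _ (Pe i)).1.
Qed.

Lemma succession_add P q f : q \in P -> succession (P :\ q) f ->
  exists g, [/\ succession P g, g q = Some q, ends P g = ends (P :\ q) f
              & #|loops P g| = #|loops (P :\ q) f|.+1].
Proof.
move=> Pq [fP finj]; pose g x := if x == q then Some q else f x.
have gq : g q = Some q by rewrite /g eqxx.
have gN x y : x \in P -> x != q -> g x = Some y -> [/\ y \in P, y != q & (x <= y)%O].
  move=> Px xq; rewrite /g (negPf xq) => /fP;
    rewrite in_setD1 xq Px => /(_ isT).
  by rewrite in_setD1 -andbA => /and3P [].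
exists g; split=> //.
- split=> [x Px y|x x' Px Px'].
    have [->|xq] := eqVneq x q; first by rewrite gq => -[<-]; rewrite Pq lexx.
    by move=> /(gN x y Px xq) [-> _ ->].
  have [->|xq] := eqVneq x q; have [->|xq'] := eqVneq x' q => //.
  - by rewrite gq => _ /esym /(gN x' q Px' xq') []; rewrite eqxx.
  - by rewrite gq => _ /(gN x q Px xq) []; rewrite eqxx.
  - by rewrite /g (negPf xq) (negPf xq'); apply: finj;
      rewrite in_setD1 ?xq ?xq'.
- by apply/setP => x; rewrite !inE /g; case: (eqVneq x q); rewrite ?andbF.
- rewrite (cardsD1 q) inE Pq gq eqxx add1n; congr _.+1; apply: eq_card => x.
  by rewrite !inE /g; case: (eqVneq x q).
Qed.

Lemma succession_del P q f : q \in P -> succession P f -> f q = Some q ->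
  [/\ succession (P :\ q) f, ends (P :\ q) f = ends P f
    & #|loops P f| = #|loops (P :\ q) f|.+1].
Proof.
move=> Pq [fP finj] fq; split.
- split=> [x /setD1P [xq Px] y fx|x x' /setD1P [_ Px] /setD1P [_ Px']].
    have /andP [Py ->] := fP x Px y fx; rewrite in_setD1 Py !andbT.
    apply: contra xq => /eqP yq; apply/eqP; apply: finj; rewrite // fx //.
    by rewrite yq fq.
  exact: finj.
- by apply/setP => x; rewrite !inE; case: (eqVneq x q) => [->|//];
    rewrite fq Pq.
- rewrite (cardsD1 q) inE Pq fq eqxx add1n; congr _.+1; apply: eq_card => x.
  by rewrite !inE andbA.
Qed.

(** Optimal families f of P \ q and g of P \ p are extended to P by a loop at q and at p. Swapping
    them on the alternating path from p puts both loops into one family, which then restricts to P \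
    {p, q}. *)
Lemma max_chains_exchange P p q k :
    p \in P -> q \in P -> p != q ->
    {in P, forall x, (x <= p)%O -> x = p} ->
    {in P, forall x, (q <= x)%O -> x = q} ->
  exists k' l', k' + l' = k.*2 /\
    max_chains (P :\ p) k + max_chains (P :\ q) k <=
      max_chains P k' + max_chains (P :\ p :\ q) l'.
Proof.
move=> Pp Pq pq minp maxq.
have [f0 [sf0 ef0 lf0]] := chains_succession (P :\ q) k.
have [g0 [sg0 eg0 lg0]] := chains_succession (P :\ p) k.
have [f [sf fq ef lf]] := succession_add Pq sf0.
have [g [sg gp eg lg]] := succession_add Pp sg0.
have [fP finj] := sf; have [gP ginj] := sg.
pose e x w := [&& x \in P, w \in P, f x == g w & isSome (f x)].
(* The left vertices of the alternating path of f and g that starts at p. *)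
pose L := [set x | connect e p x].
have Lp : p \in L by rewrite inE connect0.
have fwd x w : x \in P -> w \in P -> f x = g w -> f x -> x \in L -> w \in L.
  move=> Px Pw fg fx; rewrite !inE => /connect_trans; apply; apply: connect1.
  by rewrite /e Px Pw fg eqxx -fg.
(* Injectivity of f identifies x with the vertex before w on the path. At the start w = p, f x = g p
   = [Some p], and minimality of p gives x = p. *)
have bwd x w : x \in P -> w \in P -> f x = g w -> f x -> w \in L -> x \in L.
  move=> Px Pw fg fx; rewrite !inE => /connectP [s];
    elim/last_ind: s => [|s v _].
    move=> _ /= wp; rewrite wp gp in fg;
      have /andP [_ /minp ->//] := fP x Px p fg.
  rewrite rcons_path last_rcons => /andP [ps /and4P [Pl _ /eqP fl fl1]] wv.
  by apply/connectP; exists s => //; apply: finj; rewrite // fl -wv.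
(* Entering q from x needs f x = g q. Maximality of q forces g q = [Some q] = f q, so x was already
   q. *)
have qL : q \notin L.
  rewrite inE; apply/connectP => -[s].
  elim: s p pq {Pp minp gp L Lp fwd bwd lg0 sg0 eg0 eg lg} => [|w s IH] x xq /=.
    by move=> _ qx; rewrite qx eqxx in xq.
  case/andP => /and4P [Px Pw /eqP fg fx] ps qs; apply: (IH w) => //.
  apply: contra xq => /eqP wq; apply/eqP; apply: finj => //; rewrite fq fg wq.
  rewrite wq in fg; case E: (g q) => [y|]; last by rewrite fg E in fx.
  by have /andP [Py /maxq ->] := gP q Pq y E.
pose f' x := if x \in L then g x else f x.
pose g' x := if x \in L then f x else g x.
have sf' : succession P f'.
  split=> [x Px y|x x' Px Px']; first by rewrite /f'; case: ifP => _;
    [apply: gP | apply: fP].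
  rewrite /f'; case: ifP => Lx; case: ifP => Lx'; [exact: ginj| | |exact: finj].
    by move=> gx gf; have := bwd x' x Px' Px (esym gf);
      rewrite -gf Lx Lx' => /(_ gx isT).
  by move=> fx fg; have := bwd x x' Px Px' fg fx Lx'; rewrite Lx.
have sg' : succession P g'.
  split=> [x Px y|x x' Px Px']; first by rewrite /g'; case: ifP => _;
    [apply: fP | apply: gP].
  rewrite /g'; case: ifP => Lx; case: ifP => Lx'; [exact: finj| | |exact: ginj].
    by move=> fx fg; have := fwd x x' Px Px' fg fx Lx; rewrite Lx'.
  by move=> gx gf; have := fwd x' x Px' Px (esym gf);
    rewrite -gf Lx Lx' => /(_ gx isT).
(* The swap only trades values at each point, so total numbers of ends and of loops are
   preserved. *)
have swap (R : T -> option T -> bool) :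
    #|[set x in P | R x (f x)]| + #|[set x in P | R x (g x)]| =
    #|[set x in P | R x (f' x)]| + #|[set x in P | R x (g' x)]|.
  rewrite !card_setE -!big_split; apply: eq_bigr => x _ /=.
  by rewrite /f' /g'; case: ifP => // _; rewrite addnC.
have f'p : f' p = Some p by rewrite /f' Lp.
have f'q : f' q = Some q by rewrite /f' (negPf qL).
have [sf1 ef1 lf1] := succession_del Pp sf' f'p.
have Pq' : q \in P :\ p by rewrite in_setD1 eq_sym pq.
have [sf2 ef2 lf2] := succession_del Pq' sf1 f'q.
have hf := succession_chains sf2; have hg := succession_chains sg'.
have eE := swap (fun _ y => y == None);
  have lE := swap (fun x y => y == Some x).
rewrite -/(ends P f) -/(ends P g) -/(ends P f') -/(ends P g') in eE.
rewrite -/(loops P f) -/(loops P g) -/(loops P f') -/(loops P g') in lE.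
have le2k : #|ends P g'| + #|ends P f'| <= k.*2
  by rewrite addnC -eE ef eg -addnn leq_add.
(* The family g' may have fewer ends than this k'; monotonicity of c_k absorbs the slack and makes
   the sum exactly 2k. *)
exists (k.*2 - #|ends P f'|), #|ends P f'|; split; first by lia.
have le_g' : #|ends P g'| <= k.*2 - #|ends P f'| by lia.
have hg' := max_chains_homo P le_g'.
have cp := cardsD1 p P; have cq := cardsD1 q P; have cpq := cardsD1 q (P :\ p).
rewrite ef2 ef1 in hf; rewrite ?Pp ?Pq ?Pq' /= in cp cq cpq.
move: lf0 lg0 lf lg lE hf hg hg' cp cq cpq lf1 lf2; clearbody f' g'; clear;
  do ?move: #|_|; lia.
Qed.

End Successions.

(** * Adding boxes to shapes *)

Section Shapes.
Variables (d : Order.disp_t) (T : finPOrderType d).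
Implicit Types (P Q : {set T}) (k : nat).

Lemma max_chainsS P k : max_chains P k.+1 = max_chains P k + greene_shape P k.
Proof. by rewrite /greene_shape subnKC // max_chains_homo. Qed.

Lemma greene_shape_is_partition (prec : rel T) P :
  transitive prec -> conjugate_on prec P -> is_partition (greene_shape P).
Proof.
move=> tr cP; split=> [k|].
  by have := max_chains_concave tr k cP; rewrite !max_chainsS; lia.
exists #|P| => k lek; have := max_chainsS P k.
by rewrite !max_chains_full ?(leq_trans lek) //; lia.
Qed.

(** The gain is 0 or 1 and never drops back to 0 as k grows; it is 0 at k = 0 and 1 once k reaches
    the size of P. The new box lies in the row where it jumps. *)
Lemma max_chains_add_box P q :
    q \in P ->
    (forall k, max_chains P k + max_chains (P :\ q) k.+1 <=
               max_chains (P :\ q) k + max_chains P k.+1) ->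
  exists r, forall k, max_chains P k = max_chains (P :\ q) k + (r < k).
Proof.
move=> Pq addq.
have le k := leq_max_chains k (subsetDl P [set q]).
have ge k := max_chainsD1 P q k.
have card := cardsD1 q P; rewrite Pq /= in card.
have ex : exists r, max_chains (P :\ q) r.+1 < max_chains P r.+1.
  exists #|P|; rewrite (max_chains_full (leqnSn _)) card.
  exact: leq_ltn_trans (max_chains_le_card _ _) _.
case: (ex_minnP ex) => r gtr minr; exists r => k.
have [rk|kr] := ltnP r k.
  suff : max_chains (P :\ q) k < max_chains P k by have := ge k; lia.
  elim: k rk => // k IH; rewrite ltnS leq_eqVlt => /orP [/eqP <- //|/IH].
  by have := addq k; lia.
case: k kr => [|k] kr; first by rewrite !max_chains0.
have := minr k; have := le k.+1; lia.
Qed.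

Lemma greene_shape_add_box P Q r :
    (forall k, max_chains P k = max_chains Q k + (r < k)) ->
  forall k, greene_shape P k = greene_shape Q k + (k == r).
Proof.
move=> h k; have := max_chainsS P k; rewrite !h max_chainsS ltnS.
by have [<-|] := eqVneq k r; lia.
Qed.

(* The line of slope [m] through [(r+1, max_chains P r.+1)] lies above the
   concave function [max_chains P], strictly so from [t+1] on. *)
Lemma max_chains_support P r m t k :
    {in [pred i | i <= r], forall i, m <= greene_shape P i} ->
    {in [pred i | r < i], forall i, greene_shape P i + (t <= i) <= m} ->
    r < t ->
  max_chains P k + r.+1 * m + (t < k) <= max_chains P r.+1 + k * m.
Proof.
move=> lo hi rt; have [le|gt] := leqP k r.+1.
  rewrite -(subKn le); move: (r.+1 - k) (leq_subr k r.+1).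
  elim=> [|j IH] lej; first by rewrite subn0; lia.
  have := IH (ltnW lej); have -> : r.+1 - j = (r.+1 - j.+1).+1 by lia.
  rewrite max_chainsS mulSn; have := lo (r.+1 - j.+1); rewrite inE; lia.
rewrite -(subnK (ltnW gt)); elim: (k - r.+1) => [|j IH];
  first by rewrite add0n; lia.
rewrite addSn max_chainsS mulSn; have := hi (j + r.+1); rewrite inE; lia.
Qed.

(** For t < r, submodularity at t+1 would read 1 <= 0 after cancellation. For r < t, the exchange at
    r+1 gains 2 on the left, but concavity allows at most 1 on the right. *)
Lemma box_not_addable (prec : rel T) P p q r t :
    transitive prec -> conjugate_on prec P -> p \in P -> q \in P -> p != q ->
    {in P, forall x, ~~ prec x p} -> {in P, forall x, ~~ prec q x} ->
    {in P, forall x, (x <= p)%O -> x = p} ->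
    {in P, forall x, (q <= x)%O -> x = q} ->
    (forall k, max_chains (P :\ p) k = max_chains (P :\ p :\ q) k + (r < k)) ->
    (forall k, max_chains (P :\ q) k = max_chains (P :\ p :\ q) k + (r < k)) ->
    (forall k, max_chains P k = max_chains (P :\ p) k + (t < k)) ->
    t != r ->
  ~ is_partition (fun k => greene_shape (P :\ p :\ q) k + (k == t)).
Proof.
move=> tr cP Pp Pq pq prp prq minp maxq hp hq h tr_neq [dec _].
case: (ltngtP t r) tr_neq => // [lt_tr|lt_rt] _.
  have := max_chains_submodular tr t.+1 cP Pp Pq pq prp prq.
  by rewrite h hp hq; lia.
have [k' [l' [kl]]] := max_chains_exchange r.+1 Pp Pq pq minp maxq.
rewrite h !hp hq.
have sPpq : P :\ p :\ q \subset P by rewrite !subDset; apply/subsetP => x Px;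
  rewrite !inE Px !orbT.
have [dec0 _] := greene_shape_is_partition tr (conjugate_onS sPpq cP).
set mu := greene_shape _ in dec dec0.
have mono i j : i <= j -> mu j <= mu i.
  by move=> /subnK <-; elim: (j - i) => // n IH; apply: leq_trans (dec0 _) IH.
have sup k := @max_chains_support (P :\ p :\ q) r (mu r) t k _ _ lt_rt.
have lo : {in [pred i | i <= r], forall i, mu r <= mu i} by move=> i;
  apply: mono.
(* If a box could be added in row t, then mu t + 1 <= mu (t-1) <= mu r, as r <= t-1. *)
have hi : {in [pred i | r < i], forall i, mu i + (t <= i) <= mu r}.
  move=> i; rewrite inE => ri; have [ti|_] := leqP t i;
    last by rewrite addn0 mono // ltnW.
  have mu_t : mu t.-1 <= mu r by apply: mono; lia.
  have := dec t.-1; have -> : t.-1.+1 = t by lia.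
  rewrite eqxx (_ : (t.-1 == t) = false); last by lia.
  by have := mono t i ti; lia.
(* The linear terms cancel since k' + l' = 2(r+1), and the strictness beyond t pays for the box t of
   P. *)
have := sup lo hi k'; have := sup lo hi l'.
have : k' * mu r + l' * mu r = r.+1 * mu r + r.+1 * mu r
  by rewrite -!mulnDl addnn kl.
lia.
Qed.

End Shapes.

(** Strictly between [mu] and [rho] only [nu] and, if s differs from t, [mu] plus box t can occur.
    If r differs from s, then t = r and the latter is [kappa]; if r = s, the last hypothesis
    excludes it. *)
Lemma local_rule_of_boxes (mu kappa nu rho : nat -> nat) r s t :
    (forall k, kappa k = mu k + (k == r)) ->
    (forall k, nu k = mu k + (k == s)) ->
    (forall k, rho k = nu k + (k == t)) ->
    subshape kappa rho -> is_partition nu ->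
    (r = s -> t != r -> ~ is_partition (fun k => mu k + (k == t))) ->
  local_rule kappa mu rho nu /\
  (forall nu', local_rule kappa mu rho nu' -> nu' =1 nu).
Proof.
move=> kE nE rE sub pn nopart.
have inter : r != s -> other_intermediate kappa mu rho nu.
  move=> rs; split=> //.
  - by move/(_ s); rewrite nE kE eqxx eq_sym (negPf rs); lia.
  - by split=> [k|/(_ s)]; rewrite nE ?eqxx; lia.
  - by split=> [k|/(_ t)]; rewrite rE ?eqxx; lia.
have rt : r != s -> t = r.
  move=> rs; have := sub r; rewrite rE kE nE eqxx (negPf rs);
    case: eqVneq => // _; lia.
have main lam : other_intermediate kappa mu rho lam -> nu =1 lam.
  case=> pl lk [ml mlN] [lr lrN].
  have lamE k : mu k <= lam k <= mu k + (k == s) + (k == t).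
    by rewrite ml -nE -rE lr.
  have lam0 k : k != s -> k != t -> lam k = mu k.
    by move=> /negPf ks /negPf kt; have := lamE k; rewrite ks kt; lia.
  have neq_mu : ~ (lam s = mu s /\ lam t = mu t).
    case=> ls lt; apply: mlN => k; have [->//|ks] := eqVneq k s.
    by have [->//|kt] := eqVneq k t; rewrite lam0.
  have neq_rho : ~ (lam s = rho s /\ lam t = rho t).
    case=> ls lt; apply: lrN => k; have [->//|ks] := eqVneq k s.
    have [->//|kt] := eqVneq k t; rewrite lam0 // rE nE (negPf ks) (negPf kt);
      lia.
  move: neq_mu neq_rho (lamE s) (lamE t); rewrite !rE !nE !eqxx.
  have [st|st] := eqVneq s t.
    rewrite -st ?eqxx => n1 n2 l1 _ k; rewrite nE; have [->|ks] := eqVneq k s;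
      first lia.
    by rewrite lam0 -?st // addn0.
  move=> n1 n2 ls lt.
  have [ls1|ls1] := eqVneq (lam s) (mu s).+1.
    move=> k; rewrite nE; have [->|ks] := eqVneq k s; first by lia.
    by have [->|kt] := eqVneq k t; [lia | rewrite lam0 // addn0].
  have lamt k : lam k = mu k + (k == t).
    have [->|ks] := eqVneq k s; first by rewrite (negPf st); lia.
    by have [->|kt] := eqVneq k t; [lia | rewrite lam0 // addn0].
  have [rs|/rt tr] := eqVneq r s; last first.
    by case: lk => k; rewrite lamt kE tr.
  case: (nopart rs); first by rewrite rs eq_sym.
  case: pl => dec [N zN]; split=> [k|]; first by rewrite -!lamt.
  by exists N => k /zN; rewrite lamt.
split; first split=> // none.
  move=> k; rewrite kE nE; have [->//|/inter] := eqVneq r s.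
  by move=> oi; case: none; exists nu.
(* If r = s, an intermediate shape would equal [nu], which is the side shape [kappa]; so there is
   none and the second clause decides. *)
move=> nu' [ex nex]; have [rs|/inter] := eqVneq r s; last exact: ex.
have kn : nu =1 kappa by move=> k; rewrite kE nE rs.
move=> k; rewrite kn; apply: nex => -[lam oi]; have [_ lk _ _] := oi.
by apply: lk => l; rewrite -kn (main lam oi).
Qed.

(** * Permutation posets and their first and last points *)

Section PermPoset.
Variables (n : nat) (sigma : 'S_n).
Implicit Types (x y : 'I_n *p 'I_n) (i j : nat).

Definition right_below x y := (x.1 < y.1) && (y.2 < x.2).

Lemma right_below_trans : transitive right_below.
Proof. by move=> y x z; rewrite /right_below; lia. Qed.

Lemma perm_posetP i j x :
  reflect (exists2 k : 'I_n, i <= k.+1 <= j & x = (k, sigma k))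
          (x \in perm_poset sigma i j).
Proof.
by apply: (iffP imsetP) => -[k h ->]; exists k; rewrite ?inE // in h *.
Qed.

Lemma le_pairE x y : (x <= y)%O = (x.1 <= y.1) && (x.2 <= y.2).
Proof. by []. Qed.

Lemma perm_poset_conjugate i j : conjugate_on right_below (perm_poset sigma i j).
Proof.
move=> x y /perm_posetP [k _ ->] /perm_posetP [l _ ->].
rewrite /Order.comparable !le_pairE /right_below /=.
have [->|kl] := eqVneq k l; first by lia.
have skl : sigma k != sigma l by apply: contra kl => /eqP /perm_inj ->.
have : (k : nat) != l by []. have : (sigma k : nat) != sigma l by [].
lia.
Qed.

Lemma perm_poset_first i j (k : 'I_n) : i = k.+1 ->
  perm_poset sigma i.+1 j = perm_poset sigma i j :\ ((k, sigma k) : 'I_n *p 'I_n).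
Proof.
move=> ->; apply/setP => x; rewrite in_setD1; apply/perm_posetP/andP.
  case=> l h ->; split; last by apply/perm_posetP; exists l => //; lia.
  by apply/eqP => -[lk _]; rewrite lk in h; lia.
case=> xk /perm_posetP [l h e]; exists l => //.
have : l != k by apply: contra xk => /eqP <-; rewrite e.
by rewrite -(inj_eq val_inj) /=; lia.
Qed.

Lemma perm_poset_last i j (k : 'I_n) : (k : nat) = j ->
  perm_poset sigma i j = perm_poset sigma i j.+1 :\ ((k, sigma k) : 'I_n *p 'I_n).
Proof.
move=> <-; apply/setP => x; rewrite in_setD1; apply/perm_posetP/andP.
  case=> l h ->; split; last by apply/perm_posetP; exists l => //; lia.
  by apply/eqP => -[lk _]; rewrite lk in h; lia.
case=> xk /perm_posetP [l h e]; exists l => //.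
have : l != k by apply: contra xk => /eqP <-; rewrite e.
by rewrite -(inj_eq val_inj) /=; lia.
Qed.

Lemma perm_shape_is_partition i j : is_partition (perm_shape sigma i j).
Proof.
exact: (greene_shape_is_partition right_below_trans (@perm_poset_conjugate i j)).
Qed.

Lemma perm_poset_first_box i j (k : 'I_n) : i = k.+1 -> i <= j ->
  exists r, forall m, max_chains (perm_poset sigma i j) m =
                      max_chains (perm_poset sigma i.+1 j) m + (r < m).
Proof.
move=> ik leij; rewrite (perm_poset_first j ik).
have Pk : (k, sigma k) \in perm_poset sigma i j by apply/perm_posetP;
  exists k => //; lia.
apply: (max_chains_add_box Pk) => m.
apply: (max_chains_addition_min right_below_trans m (@perm_poset_conjugate i j) Pk).
by move=> x /perm_posetP [l h ->]; rewrite /right_below /=; lia.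
Qed.

Lemma perm_poset_last_box i j (k : 'I_n) : (k : nat) = j -> i <= j.+1 ->
  exists r, forall m, max_chains (perm_poset sigma i j.+1) m =
                      max_chains (perm_poset sigma i j) m + (r < m).
Proof.
move=> kj leij; rewrite (perm_poset_last i kj).
have Pk : (k, sigma k) \in perm_poset sigma i j.+1 by apply/perm_posetP;
  exists k => //; lia.
apply: (max_chains_add_box Pk) => m.
(* The rightmost point is maximal for [right_below], hence minimal for the converse, which is again
   conjugate. *)
apply: (max_chains_addition_min (prec := fun x y => right_below y x)) => //.
- by move=> y x z /= yx zy; apply: right_below_trans zy yx.
- by move=> x y Px Py; rewrite orbC; apply: perm_poset_conjugate Px Py.
- by move=> x /perm_posetP [l h ->]; rewrite /right_below /=; lia.
Qed.

End PermPoset.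

Theorem theorem4p1 (n : nat) (sigma : 'S_n) (i j : nat)
    (lt1i : 1 < i) (leij : i <= j) (ltjn : j < n) :
  local_rule (perm_shape sigma i.-1 j) (perm_shape sigma i j)
             (perm_shape sigma i.-1 j.+1) (perm_shape sigma i j.+1)
  /\ (forall rho : nat -> nat,
        local_rule (perm_shape sigma i.-1 j) (perm_shape sigma i j)
                   (perm_shape sigma i.-1 j.+1) rho ->
        rho =1 perm_shape sigma i j.+1).
Proof.
(* From here on [i] is the former i-1, the position of p. *)
case: i lt1i leij => [//|i] /= lt0i ltij.
have lt_pn : i.-1 < n by lia.
pose k : 'I_n := Ordinal lt_pn; pose l : 'I_n := Ordinal ltjn.
have ik : i = k.+1 by rewrite /=; lia.
have lj : (l : nat) = j by [].
pose P := perm_poset sigma i j.+1.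
pose p : 'I_n *p 'I_n := (k, sigma k); pose q : 'I_n *p 'I_n := (l, sigma l).
have Pp : p \in P by apply/perm_posetP; exists k => //; lia.
have Pq : q \in P by apply/perm_posetP; exists l => //; lia.
have pq : p != q by apply/eqP => -[] kl; lia.
have EPp : perm_poset sigma i.+1 j.+1 = P :\ p by exact: perm_poset_first.
have EPq : perm_poset sigma i j = P :\ q by exact: perm_poset_last.
have EPpq : perm_poset sigma i.+1 j = P :\ p :\ q by rewrite -EPp;
  exact: perm_poset_last.
have [r hr] := perm_poset_first_box sigma ik (ltnW ltij).
have [s hs] := perm_poset_last_box sigma lj (leqW ltij).
have [t ht] := perm_poset_first_box sigma ik (leqW (ltnW ltij)).
apply: (@local_rule_of_boxes _ _ _ _ r s t).
- exact: greene_shape_add_box.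
- exact: greene_shape_add_box.
- exact: greene_shape_add_box.
(* The outer shape also arises from the side shape by adding the last point, hence contains it. *)
- have [u hu] := perm_poset_last_box sigma lj (leqW (ltnW ltij)).
  by move=> m; rewrite /perm_shape (greene_shape_add_box hu) leq_addr.
- exact: perm_shape_is_partition.
move=> rs tr; rewrite /perm_shape EPpq.
apply: (box_not_addable (P := P) (p := p) (q := q) (r :=
  r) (@right_below_trans n)) => //.
- exact: perm_poset_conjugate.
- by move=> x /perm_posetP [m h ->]; rewrite /right_below /=; lia.
- by move=> x /perm_posetP [m h ->]; rewrite /right_below /=; lia.
- move=> x /perm_posetP [m h ->]; rewrite le_pairE /= => /andP [mk _].
  by have -> : m = k by apply: val_inj => /=; lia.
- move=> x /perm_posetP [m h ->]; rewrite le_pairE /= => /andP [lm _].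
  by have -> : m = l by apply: val_inj => /=; lia.
- by move=> m; rewrite -EPpq -EPp hs rs.
- by move=> m; rewrite -EPpq -EPq.
- by move=> m; rewrite -EPp.
Qed.
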